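(* There is an absolute constant $C>0$ such that for every complete bipartite graph $K(N_1,N_2)$ with a marked vertex $m$, there is a quantum search algorithm that deterministically (with success probability exactly $1$) finds the marked vertex using at most $C\sqrt{N_1+N_2}$ calls to the search operator $e^{-i\theta|m\rangle\langle m|}$.
   Context: The complete bipartite graph $K(N_1,N_2)$ has vertex set partitioned into $V_1$ with $|V_1|=N_1$ and $V_2$ with $|V_2|=N_2$, with an edge between every vertex of $V_1$ and every vertex of $V_2$ and no other edges. States live in the Hilbert space spanned by the orthonormal vertex basis $\{|v\rangle\}$. The algorithm uses continuous-time quantum walk operators $e^{-iAt}$ ($A$ the adjacency matrix of the graph, $t\in\mathbb R$) and search operators $e^{-i\theta|m\rangle\langle m|}$ ($\theta\in\mathbb R$); the marked vertex is accessible only through the search operator, so the algorithm's parameters do not depend on which vertex is marked. *)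

(* Defs.v *)
From HB Require Import structures.
From mathcomp Require Import all_boot all_order all_algebra.
From mathcomp Require Import all_classical all_reals all_analysis.
From mathcomp.real_closed Require Import complex.

Set Implicit Arguments.
Unset Strict Implicit.
Unset Printing Implicit Defensive.

Import Order.TTheory GRing.Theory Num.Theory numFieldNormedType.Exports.
Local Open Scope ring_scope.
Local Open Scope classical_set_scope.

Section QWalk.
Variable R : realType.

Definition mxpow n (M : 'M[R[i]]_n) (k : nat) : 'M[R[i]]_n :=
  iter k (mulmx M) 1%:M.

Definition expm_partial n (M : 'M[R[i]]_n) (K : nat) : 'M[R[i]]_n :=
  \sum_(k < K) (k`!%:R)^-1 *: mxpow M k.

Definition expm n (M : 'M[R[i]]_n) : 'M[R[i]]_n :=
  \matrix_(a, b)
    Complex (lim ((fun K => complex.Re (expm_partial M K a b)) @ \oo))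
            (lim ((fun K => complex.Im (expm_partial M K a b)) @ \oo)).

Definition inV1 N1 N2 (v : 'I_(N1 + N2)) : bool := (v < N1)%N.

Definition adjK N1 N2 : 'M[R[i]]_(N1 + N2) :=
  \matrix_(u, v) (if inV1 u != inV1 v then 1 else 0).

Definition projv n (m : 'I_n) : 'M[R[i]]_n := delta_mx m m.

Definition walk_op N1 N2 (t : R) : 'M[R[i]]_(N1 + N2) :=
  expm ((- ('i%C * t%:C%C)) *: adjK N1 N2).

Definition search_op n (m : 'I_n) (theta : R) : 'M[R[i]]_n :=
  expm ((- ('i%C * theta%:C%C)) *: projv m).

(* An elementary step of an algorithm: a walk for time t, or a call to the
   search operator with angle theta.  Parameters are independent of m. *)
Inductive gate : Type :=
| Walk of R
| Search of R.

Definition is_search (g : gate) : bool :=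
  if g is Search _ then true else false.

Definition gate_op N1 N2 (m : 'I_(N1 + N2)) (g : gate) : 'M[R[i]]_(N1 + N2) :=
  match g with
  | Walk t => walk_op N1 N2 t
  | Search theta => search_op m theta
  end.

Definition run N1 N2 (m : 'I_(N1 + N2)) (psi0 : 'cV[R[i]]_(N1 + N2))
    (gs : seq gate) : 'cV[R[i]]_(N1 + N2) :=
  foldl (fun psi g => gate_op m g *m psi) psi0 gs.

Definition sqnorm (z : R[i]) : R := complex.Re z ^+ 2 + complex.Im z ^+ 2.

Definition normalized n (psi : 'cV[R[i]]_n) : Prop :=
  \sum_(v < n) sqnorm (psi v 0) = 1.

Definition prob n (psi : 'cV[R[i]]_n) (v : 'I_n) : R := sqnorm (psi v 0).

End QWalk.

(* Main.v *)
(* The vector reached from the marked vertex [m] is tracked in the real span of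
   [m], [s] and [i s'], where [s] and [s'] are the uniform states of the side of [m]
   and of the other side.  A walk rotates the plane [Pi] of [s] and [i s'] by a
   common angle and fixes its orthogonal complement; the search operator of angle
   [pi] is the reflection through [m].  The parameters of these moves depend on the
   graph only through [a = <s, m>], so one word serves both sides.

   If a word [h] sends [m] to [phi], conjugating the search operator by [h]
   reflects through [phi]; applied after a rotation by [w], it changes
   [X = |Pi phi|^2] into [1 - (1 - X) (1 - u X)^2] with [u = 2 (1 - cos w)], and
   triples [2 n + 1], where [n] is the number of calls.  The choice [u = 4]
   amplifies, and [u = 1 / X] reaches [X = 1] exactly once [X >= 1/4].  Doing this
   first for the smaller side leaves the larger one with [X] at least the ratio of
   the two initial values, and [X = 1] is kept on the smaller side while the larger
   one is completed.  Once [h] sends [m] into [Pi] for both sides, the sequence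
   [h^-1], search of angle [pi / 2], [h], rotation by [pi / 4], [h^-1] turns
   [(s + s') / sqrt 2] into [m], whichever side [m] is on. *)

Require Import Defs.
From HB Require Import structures.
From mathcomp Require Import all_boot all_order all_algebra.
From mathcomp Require Import all_classical all_reals all_analysis.
From mathcomp.real_closed Require Import complex.
From mathcomp Require Import ring lra zify.

Set Implicit Arguments.
Unset Strict Implicit.
Unset Printing Implicit Defensive.

Import Order.TTheory GRing.Theory Num.Theory numFieldNormedType.Exports.
Local Open Scope ring_scope.

(** * Amplification of the planar weight *)

Section Amplification.
Variable R : realType.
Implicit Types (u X Y : R) (us : seq R).

(* With [X = |Pi phi|^2], this is the effect on [X] of a reflection through
   [phi] after a rotation of the plane by [w], where [u = 2 (1 - cos w)]. *)
Definition amp X u : R := 1 - (1 - X) * (1 - u * X) ^+ 2.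

Lemma amp1 us : foldl amp 1 us = 1.
Proof. by elim: us => //= u us IH; rewrite /amp subrr mul0r subr0. Qed.

(** The choice [u = 1 / X] makes the square vanish, and [X >= 1/4] keeps it at most 4. With
    [r = Y / X], the loss [(1 - Y) (1 - r)^2] is at most [1 - r], so at least [r] remains. *)
Lemma amp_last X : 4^-1 <= X <= 1 ->
  [/\ 0 <= X^-1 <= 4, amp X X^-1 = 1 &
    forall Y, 0 < Y <= X -> Y / X <= amp Y X^-1 <= 1].
Proof.
move=> /andP[X4 X1]; have X0 : 0 < X by lra.
split; first by rewrite invr_ge0 ltW//= invf_ple ?posrE.
  by rewrite /amp mulVf ?gt_eqF// subrr expr0n mulr0 subr0.
move=> Y /andP[Y0 YX]; rewrite /amp [X^-1 * Y]mulrC.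
have : Y / X <= 1 by rewrite ler_pdivrMr ?mul1r.
have : 0 < Y / X by rewrite divr_gt0.
move: (Y / X) => r r0 r1.
have S0 : 0 <= (1 - r) ^+ 2 by exact: sqr_ge0.
have S1 : (1 - r) ^+ 2 <= 1 - r by rewrite expr2 ler_piMl; lra.
by apply/andP; split; nra.
Qed.

(** For [X = sin^2 t] this is [sin^2 (3 t)], by the triple-angle formula. *)
Lemma amp4E X : amp X 4 = X * (3 - 4 * X) ^+ 2.
Proof. by rewrite /amp; ring. Qed.

(* The potential [X / (1 - X)] grows by a factor at least 9 when [u = 4]. *)
Lemma amp_small k X : 0 < X -> X < 4^-1 -> 4^-1 <= X * 4 ^+ k ->
  exists us, [/\ all (fun u => 0 <= u <= 4) us, foldl amp X us = 1,
    9 ^+ size us * X <= 27 * (1 - X) &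
    forall Y, 0 < Y <= X -> Y / X <= foldl amp Y us <= 1].
Proof.
elim: k X => [|k IH] X X0 X4 Xk; first by rewrite mulr1 in Xk; lra.
set X' := amp X 4.
have X'E : X' = X * (3 - 4 * X) ^+ 2 by exact: amp4E.
have X'X : 4 * X <= X'.
  rewrite X'E [leLHS]mulrC ler_pM2l//.
  by rewrite (_ : 4 = 2 ^+ 2 :> R) ?ler_pXn2r ?nnegrE//; lra.
have X'1 : X' <= 1.
  by rewrite /X' /amp gerBl mulr_ge0 ?sqr_ge0//; lra.
have Ymono Y : 0 < Y <= X -> (0 < amp Y 4 <= X') /\ Y / X <= amp Y 4 / X'.
  move=> /andP[Y0 YX]; rewrite amp4E X'E.
  have XY4 : (3 - 4 * X) ^+ 2 <= (3 - 4 * Y) ^+ 2.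
    by rewrite ler_pXn2r ?nnegrE//; lra.
  have Y4 : 0 < (3 - 4 * Y) ^+ 2 by rewrite exprn_gt0; lra.
  have X4' : 0 < (3 - 4 * X) ^+ 2 by rewrite exprn_gt0; lra.
  split.
    rewrite mulr_gt0//= -subr_ge0.
    have -> : X * (3 - 4 * X) ^+ 2 - Y * (3 - 4 * Y) ^+ 2 =
      (X - Y) * (12 * ((4^-1 - X) + (4^-1 - Y)) + 16 * ((4^-1 - X) ^+ 2 +
         (4^-1 - X) * (4^-1 - Y) + (4^-1 - Y) ^+ 2)) by field.
    have x0 : 0 <= 4^-1 - X by lra.
    have y0 : 0 <= 4^-1 - Y by lra.
    apply: mulr_ge0; first by rewrite subr_ge0.
    move: (4^-1 - X) (4^-1 - Y) x0 y0 => x y; nra.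
  rewrite (ler_pdivlMr _ _ (mulr_gt0 X0 X4')).
  rewrite [leLHS](_ : _ = Y * (3 - 4 * X) ^+ 2); last by field; lra.
  by rewrite ler_pM2l.
have [us [uP uX uS uY]] : exists us, [/\ all (fun u => 0 <= u <= 4) us,
    foldl amp X' us = 1, 9 * 9 ^+ size us * X <= 27 * (1 - X) &
    forall Y, 0 < Y <= X' -> Y / X' <= foldl amp Y us <= 1].
  have [X'4|X'4] := ltP X' 4^-1.
    have [||us [uP uX uS uY]] := IH X' _ X'4; first by lra.
      apply: le_trans Xk _.
      by rewrite exprS mulrA [X * 4]mulrC ler_wpM2r ?exprn_ge0.
    exists us; split=> //.
    have [P0 Q0] : 0 < (3 - 4 * X) ^+ 2 /\
        3 ^+ 2 * (1 - 4 * X) ^+ 2 <= (3 - 4 * X) ^+ 2.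
      by split; nra.
    rewrite -(ler_pM2r P0).
    have -> : 9 * 9 ^+ size us * X * (3 - 4 * X) ^+ 2 = 9 * (9 ^+ size us * X').
      by rewrite X'E; ring.
    apply: (@le_trans _ _ (9 * (27 * (1 - X')))); first by rewrite ler_pM2l.
    rewrite /X' /amp.
    rewrite [leLHS](_ : _ = 27 * (1 - X) * (3 ^+ 2 * (1 - 4 * X) ^+ 2));
      last by ring.
    by rewrite ler_pM2l// mulr_gt0//; lra.
  (* One more round suffices, and [9 * 9 * X <= 27 * (1 - X)] says exactly [X <= 1/4]; this case
     fixes the constant 27. *)
  have [|uP uX uY] := @amp_last X'; first by rewrite X'4.
  by exists [:: X'^-1]; split=> //=; rewrite ?uP// expr1; lra.
exists (4 :: us); rewrite /= uP -/X' uX exprS uS; split=> //.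
  by rewrite lexx ler0n.
move=> Y /Ymono[/uY/andP[h1 h2] h3]; rewrite h2 andbT.
exact: le_trans h1.
Qed.

Lemma amp_complete X : 0 < X <= 1 ->
  exists us, [/\ all (fun u => 0 <= u <= 4) us, foldl amp X us = 1,
    9 ^+ size us * X <= 27 &
    forall Y, 0 < Y <= X -> Y / X <= foldl amp Y us <= 1].
Proof.
move=> /andP[X0 X1]; have [X4|X4] := ltP X 4^-1; last first.
  have [|uP uX uY] := @amp_last X; first by rewrite X4.
  by exists [:: X^-1]; split=> //=; rewrite ?uP// expr1; lra.
(* Any large enough [k] will do: the length bound comes from the potential. *)
have [|us [uP uX uS uY]] := @amp_small (Num.truncn (4 * X)^-1).+1 X X0 X4.
  rewrite -ler_pdivrMl// -invfM mulrC.
  apply: le_trans (_ : (Num.truncn (4 * X)^-1).+1%:R <= _).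
    by rewrite ltW// truncnS_gt.
  by rewrite -natrX ler_nat ltnW// ltn_expl.
by exists us; split=> //; lra.
Qed.

(** Completing [X] first leaves the smaller weight at least [Y / X]; the two length bounds multiply
    and [X] cancels. *)
Lemma amp_complete2 X Y : 0 < Y <= X -> X <= 1 ->
  exists us, [/\ all (fun u => 0 <= u <= 4) us, foldl amp X us = 1,
    foldl amp Y us = 1 & 9 ^+ size us * Y <= 27 ^+ 2].
Proof.
move=> /andP[Y0 YX] X1; have X0 : 0 < X by exact: lt_le_trans YX.
have [|us [uP uX uS uY]] := @amp_complete X; first by rewrite X0.
have /andP[rle le1] := uY Y (introT andP (conj Y0 YX)).
have Z0 : 0 < foldl amp Y us by apply: lt_le_trans rle; rewrite divr_gt0.
have [|vs [vP vX vS _]] := @amp_complete (foldl amp Y us); first by rewrite Z0.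
exists (us ++ vs); rewrite all_cat uP vP !foldl_cat uX amp1 vX; split=> //.
rewrite size_cat exprD.
have -> : 9 ^+ size us * 9 ^+ size vs * Y =
   (9 ^+ size us * X) * (9 ^+ size vs * (Y / X)).
  by field; rewrite gt_eqF.
rewrite expr2; apply: ler_pM uS _.
- by rewrite mulr_ge0 ?exprn_ge0 ?ltW.
- by rewrite mulr_ge0 ?exprn_ge0 ?divr_ge0 ?ltW.
- by apply: le_trans vS; rewrite ler_pM2l ?exprn_gt0.
Qed.

End Amplification.

Arguments amp {R}.

(** * Words in the real model *)

Section Model.
Variable R : realType.
Implicit Types (a k w c s : R) (o : option R) (h : seq (option R)).

(* [State z x y] is [z (m - a s) + x s + y i s'].  In a word, [Some w] is a walk
   rotating the plane of [s] and [i s'] by [w], and [None] is the search operator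
   of angle [pi]. *)
Record state := State { sz : R; sx : R; sy : R }.
Implicit Types (p q : state).

Definition axpy k p q :=
  State (sz q + k * sz p) (sx q + k * sx p) (sy q + k * sy p).

(** The vector [m - a s] is orthogonal to [s] and has squared norm [1 - a^2]; left unnormalised, it
    may vanish, as it does for [a = 1]. *)
Definition dot a p q :=
  (1 - a ^+ 2) * sz p * sz q + sx p * sx q + sy p * sy q.

Definition target a := State 1 a 0.

Definition turn w p :=
  State (sz p) (cos w * sx p + sin w * sy p) (cos w * sy p - sin w * sx p).

Definition step a p o :=
  if o is Some w then turn w p else axpy (- 2 * dot a (target a) p) (target a) p.

Definition runs a p h := foldl (step a) p h.

Definition winv h := rev (map (omap -%R) h).

Lemma state_eq p q : sz p = sz q -> sx p = sx q -> sy p = sy q -> p = q.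
Proof. by case: p q => [? ? ?] [? ? ?] /= -> -> ->. Qed.

Lemma dotC a p q : dot a p q = dot a q p.
Proof. by rewrite /dot; ring. Qed.

Lemma dot_axpy a k p q r : dot a r (axpy k p q) = dot a r q + k * dot a r p.
Proof. by rewrite /dot /target /=; ring. Qed.

Lemma dot_target a : dot a (target a) (target a) = 1.
Proof. by rewrite /dot /target /=; ring. Qed.

Lemma runs_axpy a k p q h :
  runs a (axpy k p q) h = axpy k (runs a p h) (runs a q h).
Proof.
elim: h p q => //= o h IH p q; rewrite -IH; congr runs.
by case: o => [w|]; apply: state_eq; rewrite /= ?dot_axpy; ring.
Qed.

Lemma winvK h : winv (winv h) = h.
Proof.
rewrite /winv map_rev revK -map_comp -[RHS]map_id; apply: eq_map.
by case=> //= w; rewrite opprK.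
Qed.

Lemma winv_cons o h : winv (o :: h) = winv h ++ [:: omap -%R o].
Proof. by rewrite /winv /= rev_cons cats1. Qed.

Lemma stepK a o p : step a (step a p o) (omap -%R o) = p.
Proof.
case: o => [w|]; apply: state_eq; rewrite /= ?dot_axpy ?dot_target; try by ring.
- rewrite cosN sinN; transitivity ((cos w ^+ 2 + sin w ^+ 2) * sx p).
    by ring.
  by rewrite cos2Dsin2 mul1r.
- rewrite cosN sinN; transitivity ((cos w ^+ 2 + sin w ^+ 2) * sy p).
    by ring.
  by rewrite cos2Dsin2 mul1r.
Qed.

Lemma runsK a p h : runs a (runs a p h) (winv h) = p.
Proof.
elim: h p => //= o h IH p; rewrite winv_cons /runs foldl_cat.
by rewrite -/(runs a _ h) -/(runs a _ (winv h)) IH /= stepK.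
Qed.

Lemma runsVK a p h : runs a (runs a p (winv h)) h = p.
Proof. by rewrite -{2}(winvK h) runsK. Qed.

(** Every step is orthogonal for [dot], so its adjoint is its inverse. *)
Lemma dot_runs a p q h : dot a (runs a p h) q = dot a p (runs a q (winv h)).
Proof.
elim: h p q => //= o h IH p q; rewrite winv_cons /runs foldl_cat.
rewrite -/(runs a _ h) -/(runs a _ (winv h)) IH /=.
move: (runs a q (winv h)) => r.
case: o => [w|] /=; first by rewrite /dot /= cosN sinN; ring.
by rewrite dotC !dot_axpy !(dotC a _ (target a)) (dotC a r p); ring.
Qed.

Definition planar a h :=
  sx (runs a (target a) h) ^+ 2 + sy (runs a (target a) h) ^+ 2.

Lemma norm_runs a h :
  (1 - a ^+ 2) * sz (runs a (target a) h) ^+ 2 = 1 - planar a h.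
Proof.
have : dot a (runs a (target a) h) (runs a (target a) h) = 1.
  by rewrite dot_runs runsK dot_target.
by rewrite /planar /dot => D; lra.
Qed.

Definition amplify w h := h ++ Some w :: winv h ++ None :: h.

Lemma runs_amplify a w h : let p := runs a (target a) h in
  runs a (target a) (amplify w h) = axpy (- 2 * dot a p (turn w p)) p (turn w p).
Proof.
move=> p; rewrite /amplify /runs foldl_cat /= foldl_cat /= -!/(runs _ _ _).
by rewrite -/p runs_axpy runsVK -[dot a (target a) _]dot_runs.
Qed.

Definition calls h := count (fun o => ~~ o) h.

Lemma calls_winv h : calls (winv h) = calls h.
Proof.
by rewrite /calls /winv count_rev count_map; apply: eq_count => -[].
Qed.

Lemma calls_amplify w h : (calls (amplify w h)).*2.+1 = (3 * (calls h).*2.+1)%N.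
Proof.
by rewrite /amplify /calls !count_cat /= count_cat /= -!/(calls _) calls_winv; lia.
Qed.

(** The complementary weight is easier to follow: the [sz] coordinate is multiplied by
    [1 - 2 (1 - u X / 2) = - (1 - u X)]. *)
Lemma planar_amplify a w h :
  planar a (amplify w h) = amp (planar a h) (2 * (1 - cos w)).
Proof.
have D := norm_runs a h; have := norm_runs a (amplify w h).
rewrite runs_amplify; set p := runs a (target a) h.
have -> : dot a p (turn w p) = 1 - planar a h + cos w * planar a h.
  by rewrite -D /planar /dot -/p /=; ring.
move=> /= E; apply: (can_inj (subKr 1)); rewrite -E /amp subKr -[in RHS]D -/p.
by ring.
Qed.

Lemma planar_foldl_amplify a us h : all (fun u => 0 <= u <= 4) us ->
  planar a (foldl (fun h u => amplify (acos (1 - u / 2)) h) h us) =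
  foldl amp (planar a h) us.
Proof.
elim: us h => //= u us IH h /andP[/andP[u0 u4] /IH ->].
rewrite planar_amplify acosK ?in_itv/=; last by apply/andP; split; lra.
by congr (foldl _ (amp _ _) _); field.
Qed.

Lemma calls_foldl_amplify us h :
  (calls (foldl (fun h u => amplify (acos (1 - u / 2)) h) h us)).*2.+1 =
  (3 ^ size us * (calls h).*2.+1)%N.
Proof.
elim: us h => [|u us IH] h /=; first by rewrite mul1n.
by rewrite IH calls_amplify expnS mulnA [(3 ^ _ * 3)%N]mulnC.
Qed.

Lemma planar_complete a b : 0 < b <= a -> a <= 1 -> exists h,
  [/\ planar a h = 1, planar b h = 1 & (calls h).*2.+1%:R * b <= 27].
Proof.
move=> /andP[b0 ba] a1.
have [||us [uP ua ub uS]] := @amp_complete2 _ (a ^+ 2) (b ^+ 2).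
- by rewrite exprn_gt0//= ler_pXn2r ?nnegrE//; lra.
- by rewrite expr_le1//; lra.
exists (foldl (fun h u => amplify (acos (1 - u / 2)) h) [::] us).
have nil c : planar c [::] = c ^+ 2 by rewrite /planar /=; ring.
rewrite !planar_foldl_amplify// !nil calls_foldl_amplify muln1; split=> //.
(* Squaring turns [3 ^ k] into [9 ^ k], the form in which the length is bounded. *)
rewrite -(@ler_pXn2r _ 2) ?nnegrE//; last by rewrite mulr_ge0// ltW.
by rewrite exprMn natrX exprAC -natrX.
Qed.

(* Searching for [phi = runs (target a) h], which lies on the great circle
   through [s] and [i s'], with [h^-1] as the search operator: the initial state
   [(s + s') / sqrt 2], with real part [p] and imaginary part [q], is one of the
   two poles of that circle, and the phase [- i] at [phi] moves it onto the circle,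
   at an angle [pi / 4] from [phi]. *)
Lemma last_stage a h (r := Num.sqrt 2^-1) (w := acos r)
    (p := runs a (State 0 r 0) (winv h)) (q := runs a (State 0 0 (- r)) (winv h))
    (tp := dot a (target a) p) (tq := dot a (target a) q)
    (p' := runs a (axpy (tq - tp) (target a) p) (h ++ Some w :: winv h))
    (q' := runs a (axpy (- (tp + tq)) (target a) q) (h ++ Some w :: winv h)) :
  planar a h = 1 -> dot a (target a) p' ^+ 2 + dot a (target a) q' ^+ 2 = 1.
Proof.
move=> X1; set f := runs a (target a) h.
have zf : (1 - a ^+ 2) * sz f * sz f = 0.
  by have := norm_runs a h; rewrite X1 subrr -/f => <-; ring.
have rr : r ^+ 2 = 2^-1 by rewrite sqr_sqrtr.
have r1 : -1 <= r <= 1.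
  have r0 : 0 <= r by exact: sqrtr_ge0.
  by apply/andP; split; nra.
have cw : cos w = r by rewrite acosK ?in_itv.
have sw : sin w = r by rewrite sin_acos// rr; congr Num.sqrt; field.
have fE k v : dot a (target a) (runs a (axpy k (target a) (runs a v (winv h)))
    (h ++ Some w :: winv h)) = dot a f (turn w v) + k * dot a f (turn w f).
  have runsE u : dot a (target a) (runs a u (h ++ Some w :: winv h)) =
      dot a f (turn w (runs a u h)).
    by rewrite /f dot_runs /runs foldl_cat.
  by rewrite runs_axpy dot_axpy !runsE runsVK.
have tpE : tp = r * sx f by rewrite /tp /p -dot_runs -/f /dot /=; ring.
have tqE : tq = - r * sy f by rewrite /tq /q -dot_runs -/f /dot /=; ring.
have ffE : dot a f (turn w f) = r.
  have := X1; rewrite /planar -/f /dot /= zf cw sw => E.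
  by rewrite -[RHS]mulr1 -E; ring.
(* The two amplitudes come out as [- 2 r^2 sy f] and [- 2 r^2 sx f]. *)
rewrite !fE ffE tpE tqE {1 2}/dot /= cw sw.
rewrite -[RHS]X1 /planar -/f.
transitivity ((2 * r ^+ 2) ^+ 2 * (sx f ^+ 2 + sy f ^+ 2)); first by ring.
by rewrite rr divff// expr1n mul1r.
Qed.

End Model.

(** * Exponentials of matrices with A^3 = w^2 A *)

Section Exponential.
Local Open Scope classical_set_scope.
Variable R : realType.
Local Notation C := R[i].
Variables (n : nat) (A : 'M[R]_n) (w t : R).
Hypotheses (w0 : w != 0) (A3 : A *m A *m A = w ^+ 2 *: A).

Local Notation M := ((- ('i%C * t%:C%C)) *: map_mx (real_complex R) A).

(** Divided by [k!], [al k] and [be k] are the Taylor terms of cosine and sine at [w * t]. *)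
Let al k : R := (~~ odd k)%:R * (-1) ^+ k./2 * (w * t) ^+ k.
Let be k : R := (odd k)%:R * (-1) ^+ k.-1./2 * (w * t) ^+ k.

Let alS k : al k.+1 = - (w * t) * be k.
Proof.
rewrite /al /be /=; case: (boolP (odd k)) => ok /=; last by rewrite !(mul0r, mulr0).
by case: k ok => //= k _; rewrite !exprS; ring.
Qed.

Let beS k : be k.+1 = w * t * al k.
Proof. by rewrite /al /be /= exprS; ring. Qed.

(** By [A3], odd powers are multiples of [A] and even ones of [A *m A]; power 0 is left out, since
    the identity need not be such a multiple. *)
Lemma mxpow_cubic k : mxpow M k.+1 =
  (al k.+1 / w ^+ 2)%:C%C *: map_mx (real_complex R) (A *m A)
  - ('i%C * (be k.+1 / w)%:C%C) *: map_mx (real_complex R) A.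
Proof.
elim: k => [|k IH].
  rewrite /mxpow /= mulmx1 /al /be /= !mul0r scale0r sub0r -scaleNr.
  by congr (- (_ * _%:C%C) *: _); field.
rewrite /mxpow iterS -/(mxpow _ _) IH.
rewrite mulmxBr -!scalemxAl -!scalemxAr -!map_mxM mulmxA A3 map_mxZ !scalerA.
rewrite addrC -!scaleNr (alS k.+1) (beS k.+1).
congr (_ *: _ + _ *: _); simpc; congr Complex; by field.
Qed.

Lemma expm_cubic : expm M = \matrix_(i, j)
  Complex ((i == j)%:R + (cos (w * t) - 1) / w ^+ 2 * (A *m A) i j)
          (- (sin (w * t) / w * A i j)).
Proof.
(* The [- 1] removes the constant term of cosine, which belongs to the identity. The formula fails
   for the empty sum, hence the shift to [K.+1]. *)
have partE K i j : expm_partial M K.+1 i j =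
  Complex ((i == j)%:R +
            (series (cos_coeff (w * t)) K.+1 - 1) / w ^+ 2 * (A *m A) i j)
          (- (series (sin_coeff (w * t)) K.+1 / w * A i j)).
  elim: K => [|K IH].
    rewrite /expm_partial big_ord1 /mxpow /series /= !big_nat1 !mxE.
    rewrite /cos_coeff /sin_coeff /= !mul0r oppr0 fact0 expr0z expr0 !mul1r.
    by rewrite !invr1 subrr !mul0r addr0 mul1r; case: (i == j).
  rewrite /expm_partial big_ord_recr mxE -/(expm_partial M K.+1) IH.
  rewrite [nat_of_ord _]/= mxpow_cubic /series /=.
  rewrite ![in RHS](@big_nat_recr _ _ _ K.+1)//=.
  rewrite !mxE.
  have -> : (K.+1`!%:R : C)^-1 = (K.+1`!%:R^-1 : R)%:C%C.
    by rewrite fmorphV rmorph_nat.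
  rewrite /cos_coeff /sin_coeff /= -exprnP -/(al K.+1) -/(be K.+1).
  move: (K.+1`!%:R^-1) (i == j)%:R => F d; simpc.
  by congr Complex; field.
have lim_shift (u : nat -> R) (l : R) :
    (u \o succn) @ \oo --> l -> lim (u @ \oo) = l.
  by move=> ul; apply/cvg_lim => //; rewrite -(cvg_shiftS u).
apply/matrixP => i j; rewrite mxE [RHS]mxE; congr Complex; apply: lim_shift.
- rewrite [X in X @ _ --> _](_ : _ = fun K => (i == j)%:R +
    (series (cos_coeff (w * t)) K.+1 - 1) / w ^+ 2 * (A *m A) i j); last first.
    by apply/funext => K; rewrite /= partE.
  apply: cvgD; first exact: cvg_cst.
  do 2 (apply: cvgM; last exact: cvg_cst).
  apply: cvgB; last exact: cvg_cst.
  have := @is_cvg_series_cos_coeff _ (w * t).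
  by rewrite -(cvg_shiftS (series _)) unlock.
- rewrite [X in X @ _ --> _](_ : _ = fun K =>
    - (series (sin_coeff (w * t)) K.+1 / w * A i j)); last first.
    by apply/funext => K; rewrite /= partE.
  apply: cvgN; do 2 (apply: cvgM; last exact: cvg_cst).
  have := @is_cvg_series_sin_coeff _ (w * t).
  by rewrite -(cvg_shiftS (series _)) unlock.
Qed.

Lemma expm_cubicE : expm M = 1%:M
  + ((cos (w * t) - 1) / w ^+ 2)%:C%C *: map_mx (real_complex R) (A *m A)
  - ('i%C * (sin (w * t) / w)%:C%C) *: map_mx (real_complex R) A.
Proof.
rewrite expm_cubic; apply/matrixP => i j; rewrite !mxE.
by case: (i == j); simpc.
Qed.

End Exponential.

(** * Walk and search operators in the model *)

(** A projector satisfies the cubic relation with [w = 1]; the scalar is [e^(- i theta) - 1]. *)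
Lemma search_op_mulmx (R : realType) n (m : 'I_n) (theta : R) (x : 'cV[R[i]]_n) :
  search_op m theta *m x =
  x + (Complex (cos theta - 1) (- sin theta) * x m 0) *: delta_mx m 0.
Proof.
have P2 : delta_mx m m *m delta_mx m m = delta_mx m m :> 'M[R]_n.
  by rewrite mul_delta_mx.
rewrite /search_op /projv -[X in expm (_ *: X)](map_delta_mx (real_complex R)).
rewrite (@expm_cubicE R n (delta_mx m m) 1 theta) ?oner_eq0 ?P2 ?expr1n
  ?scale1r// mul1r !divr1.
rewrite map_delta_mx mulmxBl mulmxDl mul1mx -!scalemxAl -addrA -scalerBl.
have -> : delta_mx m m *m x = x m 0 *: delta_mx m 0.
  apply/matrixP => i j; rewrite !mxE ord1 eqxx andbT.
  rewrite (bigD1 m)//= big1 ?addr0 => [|k km]; rewrite !mxE; last first.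
    by rewrite (negbTE km) andbF mul0r.
  by rewrite eqxx andbT mulrC.
by rewrite scalerA; congr (_ + _ * _ *: _); simpc.
Qed.

Section Embedding.
Variables (R : realType) (N1 N2 : nat).
Hypotheses (N1_gt0 : (0 < N1)%N) (N2_gt0 : (0 < N2)%N).
Implicit Types (b : bool) (m v : 'I_(N1 + N2)) (p q : state R).

Definition side b : nat := if b then N1 else N2.

Local Notation sq b := (Num.sqrt (side b)%:R : R).

(** The nonzero eigenvalues of the adjacency matrix are plus and minus this number. *)
Definition freq : R := sq true * sq false.

Definition adjR : 'M[R]_(N1 + N2) := \matrix_(u, v) (inV1 u != inV1 v)%:R.

Let side_gt0 b : 0 < (side b)%:R :> R.
Proof. by rewrite ltr0n; case: b. Qed.

Let sq_gt0 b : 0 < sq b.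
Proof. by rewrite sqrtr_gt0. Qed.

Let sq_neq0 b : sq b != 0.
Proof. by rewrite gt_eqF. Qed.

Let sqK b : sq b ^+ 2 = (side b)%:R.
Proof. by rewrite sqr_sqrtr// ltW. Qed.

Lemma freqE b : freq = sq b * sq (~~ b).
Proof. by rewrite /freq; case: b => //=; rewrite mulrC. Qed.

Lemma freq_neq0 : freq != 0.
Proof. by rewrite mulf_neq0. Qed.

Lemma sum_side b (c : R) :
  \sum_(v < N1 + N2) (if inV1 v == b then c else 0) = (side b)%:R * c.
Proof.
rewrite big_split_ord /=.
rewrite (eq_bigr (fun=> if b then c else 0)) => [|i _]; last first.
  by rewrite /inV1 /= ltn_ord; case: b.
rewrite [X in _ + X](eq_bigr (fun=> if b then 0 else c)) => [|i _]; last first.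
  by rewrite /inV1 /= ltnNge leq_addr; case: b.
by rewrite !sumr_const !card_ord; case: b; rewrite /= mul0rn ?addr0 ?add0r mulr_natl.
Qed.

(* Real and imaginary parts of a model vector; they are supported on the side of
   [m] and on the other side respectively. *)
Definition near_part m (z x : R) : 'cV[R]_(N1 + N2) := \col_v
  if inV1 v == inV1 m
  then z * ((v == m)%:R - (side (inV1 m))%:R^-1) + x / sq (inV1 m) else 0.

Definition far_part m (y : R) : 'cV[R]_(N1 + N2) := \col_v
  if inV1 v == ~~ inV1 m then y / sq (~~ inV1 m) else 0.

Definition emb m p : 'cV[R[i]]_(N1 + N2) :=
  map_mx (real_complex R) (near_part m (sz p) (sx p))
  + 'i%C *: map_mx (real_complex R) (far_part m (sy p)).

Lemma sum_near m z x : \sum_v near_part m z x v 0 = sq (inV1 m) * x.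
Proof.
pose M : R := (side (inV1 m))%:R.
rewrite (eq_bigr (fun v => z * (v == m)%:R +
  (if inV1 v == inV1 m then x / sq (inV1 m) - z / M else 0))); last first.
  move=> v _; rewrite mxE; case: eqP => [_|]; first by rewrite /M; ring.
  by case: eqP => [->//|]; rewrite mulr0 addr0.
rewrite big_split /= sum_side (bigD1 m)//= big1 => [|v /negbTE ->]; last first.
  by rewrite mulr0.
rewrite eqxx mulr1 addr0 /M; move: (sqK (inV1 m)) (sq_neq0 (inV1 m)).
by move: (sq (inV1 m)) => r <- r0; field.
Qed.

(** The [z] component sums to zero over its side, so adjacency kills it, while [s] goes to [freq]
    times [s']. *)
Lemma adjR_near m z x : adjR *m near_part m z x = freq *: far_part m x.
Proof.
apply/matrixP => u j; rewrite !mxE ord1.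
case: (boolP (inV1 u == ~~ inV1 m)) => um.
  transitivity (\sum_v near_part m z x v 0).
    apply: eq_bigr => v _; rewrite !mxE (eqP um).
    by case: (inV1 v) (inV1 m) => -[]; rewrite ?mul1r ?mulr0.
  rewrite sum_near (freqE (inV1 m)).
  have := sq_neq0 (~~ inV1 m).
  by move: (sq (inV1 m)) (sq (~~ inV1 m)) => r r' r0; field.
rewrite mulr0 big1// => v _; rewrite !mxE.
by case: (inV1 u) (inV1 m) (inV1 v) um => -[] -[]; rewrite ?mul0r ?mulr0.
Qed.

Lemma adjR_far m y : adjR *m far_part m y = freq *: near_part m 0 y.
Proof.
apply/matrixP => u j; rewrite !mxE ord1.
case: (boolP (inV1 u == inV1 m)) => um.
  transitivity (\sum_v far_part m y v 0).
    apply: eq_bigr => v _; rewrite !mxE (eqP um).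
    by case: (inV1 v) (inV1 m) => -[]; rewrite ?mul1r ?mulr0.
  under eq_bigr do rewrite mxE.
  rewrite sum_side (freqE (inV1 m)) mul0r add0r.
  move: (sqK (~~ inV1 m)) (sq_neq0 (inV1 m)) (sq_neq0 (~~ inV1 m)).
  by move: (sq (inV1 m)) (sq (~~ inV1 m)) => r r' <- r0 r0'; field; rewrite r0 r0'.
rewrite mulr0 big1// => v _; rewrite !mxE.
by case: (inV1 u) (inV1 m) (inV1 v) um => -[] -[]; rewrite ?mul0r ?mulr0.
Qed.

Lemma adjR3 : adjR *m adjR *m adjR = freq ^+ 2 *: adjR.
Proof.
apply/matrixP => u v; rewrite !mxE.
have A2 x : (adjR *m adjR) u x = (inV1 u == inV1 x)%:R * (side (~~ inV1 u))%:R.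
  rewrite mxE [RHS]mulrC -sum_side; apply: eq_bigr => y _; rewrite !mxE.
  by case: (inV1 u) (inV1 x) (inV1 y) => -[] -[]; rewrite /= ?mul1r ?mul0r.
under eq_bigr do rewrite A2 mxE.
rewrite (freqE (inV1 u)) exprMn !sqK -mulrA -sum_side.
apply: eq_bigr => y _.
by case: (inV1 u) (inV1 v) (inV1 y) => -[] -[]; rewrite /= ?mul1r ?mul0r ?mulr0 ?mulr1.
Qed.

Lemma map_adjR : map_mx (real_complex R) adjR = adjK R N1 N2.
Proof. by apply/matrixP => u v; rewrite !mxE; case: ifP. Qed.

Lemma nearZD m k z x z' x' :
  near_part m (z' + k * z) (x' + k * x) = near_part m z' x' + k *: near_part m z x.
Proof. by apply/matrixP => v j; rewrite !mxE; case: ifP => _; ring. Qed.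

Lemma farZD m k y y' : far_part m (y' + k * y) = far_part m y' + k *: far_part m y.
Proof. by apply/matrixP => v j; rewrite !mxE; case: ifP => _; ring. Qed.

Lemma emb_axpy m k p q : emb m (axpy k p q) = emb m q + k%:C%C *: emb m p.
Proof.
rewrite /emb /= nearZD farZD !map_mxD !map_mxZ !scalerDr !scalerA.
by rewrite (mulrC k%:C%C); apply: addrACA.
Qed.

Lemma walk_op_emb m w p : walk_op N1 N2 (w / freq) *m emb m p = emb m (turn w p).
Proof.
rewrite /walk_op -map_adjR (expm_cubicE _ freq_neq0 adjR3).
rewrite [freq * _]mulrC divfK ?freq_neq0//.
case: p => z x y; rewrite /emb /turn /=.
rewrite mulmxBl mulmxDl mul1mx -!scalemxAl !mulmxDr -!scalemxAr -!map_mxM.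
rewrite -!mulmxA !adjR_near !adjR_far -!scalemxAr !adjR_near !adjR_far.
rewrite !map_mxZ !scalerA.
have entry (c1 c2 c3 c4 c5 c6 c7 : R[i])
    (x1 x2 x3 x4 x5 x6 : 'cV[R[i]]_(N1 + N2)) v j :
    (x1 + c1 *: x2 + c2 *: (c3 *: x3 + c4 *: x4) - c5 *: (c6 *: x5 + c7 *: x6)) v j =
    x1 v j + c1 * x2 v j + c2 * (c3 * x3 v j + c4 * x4 v j)
    - c5 * (c6 * x5 v j + c7 * x6 v j).
  by rewrite !mxE.
apply/matrixP => v j; apply: etrans (entry _ _ _ _ _ _ _ _ _ _ _ _ _ _ _) _.
rewrite !mxE; move: freq freq_neq0 => f f0.
move: (sq (inV1 m))^-1 (sq (~~ inV1 m))^-1 (side (inV1 m))%:R^-1 => r r' M.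
by case: (inV1 v == inV1 m) (inV1 v == ~~ inV1 m) => -[]; simpc;
  congr Complex; field.
Qed.

Lemma emb_target m (a := (sq (inV1 m))^-1) : emb m (target a) = delta_mx m 0.
Proof.
apply/matrixP => v j; rewrite /target !mxE ord1 andbT /=.
case: (boolP (v == m)) => [/eqP ->|vm].
  rewrite eqxx mulr1n mul0r if_same; simpc; congr (_%:C)%C.
  rewrite /a; move: (sqK (inV1 m)) (sq_neq0 (inV1 m)).
  by move: (sq (inV1 m)) => r <- r0; field.
rewrite mulr0n mul0r if_same; simpc; congr (_%:C)%C.
case: ifP => _; rewrite // /a; move: (sqK (inV1 m)) (sq_neq0 (inV1 m)).
by move: (sq (inV1 m)) => r <- r0; field.
Qed.

Lemma emb_dot m (a := (sq (inV1 m))^-1) p :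
  emb m p m 0 = (dot a (target a) p)%:C%C.
Proof.
have mF : inV1 m == ~~ inV1 m = false by case: (inV1 m).
rewrite !mxE !eqxx mF mulr1n; simpc; congr (_%:C)%C; rewrite /dot /=.
rewrite /a; move: (sqK (inV1 m)) (sq_neq0 (inV1 m)).
by move: (sq (inV1 m)) => r <- r0; field.
Qed.

Let addiZE (x y : 'cV[R[i]]_(N1 + N2)) m :
  (x + 'i%C *: y) m 0 = x m 0 + 'i%C * y m 0.
Proof. by rewrite !mxE. Qed.

Definition to_gates h : seq (gate R) :=
  map (fun o => if o is Some w then Walk (w / freq) else Search pi) h.

Lemma count_to_gates h : count (@is_search R) (to_gates h) = calls h.
Proof. by rewrite /to_gates count_map; apply: eq_count => -[]. Qed.

(** The start vector lies outside the real span of the model; by complex linearity, two model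
    vectors evolve side by side. *)
Lemma run_to_gates m (a := (sq (inV1 m))^-1) p q h :
  run m (emb m p + 'i%C *: emb m q) (to_gates h) =
  emb m (runs a p h) + 'i%C *: emb m (runs a q h).
Proof.
elim: h p q => [//|o h IH] p q.
apply: etrans (IH (step a p o) (step a q o)); congr (run m _ (to_gates h)).
have gateE r : gate_op m (if o is Some w then Walk (w / freq) else Search pi) *m
    emb m r = emb m (step a r o).
  case: o => [w|] /=; first exact: walk_op_emb.
  rewrite search_op_mulmx emb_dot emb_axpy emb_target cospi sinpi.
  by congr (_ + _ *: _); simpc; congr (_%:C)%C; rewrite /a; ring.
by rewrite mulmxDr -scalemxAr !gateE.
Qed.

Lemma search_pihalf m (a := (sq (inV1 m))^-1) p q
    (tp := dot a (target a) p) (tq := dot a (target a) q) :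
  search_op m (pi / 2) *m (emb m p + 'i%C *: emb m q) =
  emb m (axpy (tq - tp) (target a) p)
  + 'i%C *: emb m (axpy (- (tp + tq)) (target a) q).
Proof.
have comb (x y d : 'cV[R[i]]_(N1 + N2)) (c k1 k2 : R[i]) : c = k1 + 'i%C * k2 ->
    x + 'i%C *: y + c *: d = x + k1 *: d + 'i%C *: (y + k2 *: d).
  by move=> ->; rewrite scalerDr scalerA scalerDl addrACA.
rewrite search_op_mulmx addiZE !emb_dot -/a -/tp -/tq !emb_axpy emb_target.
by apply: comb; rewrite cos_pihalf sin_pihalf; simpc; congr Complex; ring.
Qed.

(** * The start state and the assembled algorithm *)

Definition start : 'cV[R[i]]_(N1 + N2) :=
  \col_v (Num.sqrt 2^-1 / sq (inV1 v))%:C%C.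

(** The outer [i] turns [- r] times [i s'] into [r s']. Only the decomposition depends on [m]. *)
Lemma startE m (r := Num.sqrt 2^-1 : R) :
  start = emb m (State 0 r 0) + 'i%C *: emb m (State 0 0 (- r)).
Proof.
apply/matrixP => v j; rewrite !mxE /=.
case: (inV1 v) (inV1 m) => -[]; simpc; rewrite /= ?mul0r ?add0r ?opprK //.
all: by rewrite ?(mulNr, opprK, oppr0).
Qed.

Lemma start_normalized : normalized start.
Proof.
rewrite /normalized.
transitivity (\sum_(v < N1 + N2) \sum_(b : bool)
    (if inV1 v == b then (2 * (side b)%:R)^-1 else 0) : R).
  apply: eq_bigr => v _; rewrite big_bool !mxE /sqnorm /= expr0n addr0.
  rewrite exprMn exprVn sqK sqr_sqrtr// -invfM.
  by case: (inV1 v); rewrite ?addr0 ?add0r.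
rewrite exchange_big big_bool /= !sum_side.
have := side_gt0 true; have := side_gt0 false.
by move: (side true)%:R (side false)%:R => c d c0 d0; field; lra.
Qed.

Lemma search_word : exists h, (forall b, planar (sq b)^-1 h = 1) /\
  (calls h).*2.+1%:R <= 27 * Num.sqrt (N1 + N2)%:R :> R.
Proof.
(* Here [b] is the larger side, whose overlap with the marked vertex is the smaller and governs the
   cost. *)
have [b bP] : exists b, (side (~~ b) <= side b)%N.
  by have [] := leqP N1 N2; [exists false | move/ltnW; exists true].
have [||h [h1 h2 hS]] := @planar_complete R (sq (~~ b))^-1 (sq b)^-1.
- by rewrite invr_gt0 sq_gt0 /= lef_pV2 ?posrE ?sq_gt0 // ler_wsqrtr// ler_nat.
- by rewrite invf_le1 ?sq_gt0// -[leLHS]sqrtr1 ler_wsqrtr// ler1n -(ltr0n R) side_gt0.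
exists h; split.
  by move=> c; have [->|->] : c = b \/ c = ~~ b by case: (c) (b) => -[]; auto.
rewrite ler_pdivrMr ?sq_gt0// in hS; apply: le_trans hS _.
rewrite ler_pM2l// ler_wsqrtr// ler_nat /side.
by case: (b); rewrite ?leq_addr ?leq_addl.
Qed.

Definition search_gates h : seq (gate R) :=
  to_gates (winv h) ++ Search (pi / 2) ::
  to_gates (h ++ Some (acos (Num.sqrt 2^-1)) :: winv h).

Lemma count_search_gates h :
  count (@is_search R) (search_gates h) = (3 * calls h).+1.
Proof.
rewrite /search_gates count_cat /= !count_to_gates calls_winv.
rewrite /calls count_cat /= -!/(calls _) calls_winv; move: (calls h) => c.
by clear; lia.
Qed.

Lemma prob_search_gates m h : planar (sq (inV1 m))^-1 h = 1 ->
  prob (run m start (search_gates h)) m = 1.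
Proof.
move=> X1; rewrite /search_gates /run foldl_cat /= -!/(run _ _ _) (startE m).
rewrite run_to_gates search_pihalf run_to_gates -[RHS](last_stage X1) /prob.
by rewrite addiZE !emb_dot /sqnorm; simpc.
Qed.

End Embedding.

Theorem theorem3 (R : realType) :
  exists C : R, 0 < C /\
  forall N1 N2 : nat, (0 < N1)%N -> (0 < N2)%N ->
  exists (psi0 : 'cV[R[i]]_(N1 + N2)) (gs : seq (gate R)),
    [/\ normalized psi0,
        (count (@is_search R) gs)%:R <= C * Num.sqrt ((N1 + N2)%:R) &
        forall m : 'I_(N1 + N2), prob (run m psi0 gs) m = 1].
Proof.
(* If [h] makes [c] calls, then [2 (3 c + 1) <= 3 (2 c + 1) <= 81 sqrt (N1 + N2)], and
   [81 / 2 <= 41]. *)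
exists 41; split=> // N1 N2 N1_gt0 N2_gt0.
have [h [h1 hS]] := search_word R N1_gt0 N2_gt0.
exists (start R N1 N2), (search_gates N1 N2 h); split.
- exact: start_normalized.
- rewrite count_search_gates.
  have : 2 * (3 * calls h).+1%:R <= 3 * (calls h).*2.+1%:R :> R.
    by rewrite -!natrM ler_nat; lia.
  move: (sqrtr_ge0 ((N1 + N2)%:R : R)) hS; move: (Num.sqrt _) => r r0 hS; lra.
- by move=> m; apply: prob_search_gates (h1 _).
Qed.
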